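(* Let $T=(V,E)$ be an infinite locally finite tree with a fixed root $o\in V$, let $\Xi=\{1,\dots,q\}$, and let $\mu$ be a Markov chain over $T$ on $(\Omega,\mathcal B)=(\Xi^V,\mathcal B)$, where $\mathcal B$ is the cylinder $\sigma$-algebra. Then for each $x\in V$, $$\mu\big[\xi(\cdot)\text{ on }S(x)\,\big|\,\xi(\cdot)\text{ on }V\setminus T'(x)\big]=\prod_{y\in S(x)}\mu[\xi(y)\mid\xi(x)],$$ that is, for every $a\in\Xi^{S(x)}$, $\mu\big(\xi(y)=a_y\ \forall y\in S(x)\,\big|\,\mathcal F_{V\setminus T'(x)}\big)=\prod_{y\in S(x)}\mu\big(\xi(y)=a_y\,\big|\,\mathcal F_{\{x\}}\big)$ $\mu$-almost surely. If, in addition, for each $x\in V$ the $\sigma$-algebras $(\mathcal F_{\{y\}})_{y\in S(x)}$ are conditionally independent given $\mathcal F_{\{x\}}$, then $\mu$ is an $o$-block Markov chain.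
   Context: For $\Lambda\subseteq V$, $\mathcal F_\Lambda$ is the sub-$\sigma$-algebra of $\mathcal B$ generated by the coordinate maps $\xi\mapsto\xi(u)$, $u\in\Lambda$. An identity $\mu[\xi(\cdot)\text{ on }A\mid \xi(\cdot)\text{ on }B]=\mu[\xi(\cdot)\text{ on }A\mid\xi(\cdot)\text{ on }C]$ means that for every event $F\in\mathcal F_A$ one has $\mu(F\mid\mathcal F_B)=\mu(F\mid\mathcal F_C)$ $\mu$-almost surely. Write $x\sim y$ if $x,y$ are joined by an edge, $d$ for the graph distance, and $N_x=\{y\in V: y\sim x\}$. With respect to the root $o$: $S(x)=\{y\in V: y\sim x,\ d(y,o)>d(x,o)\}$ (direct successors), $S_1(x)=S(x)$, $S_{k+1}(x)=\bigcup_{y\in S_k(x)}S(y)$, and $T'(x)=\bigcup_{k\ge1}S_k(x)$ (strict descendants). $\mu$ is an $o$-block Markov chain ($o$-BMC) if for all $x\in V$: $\mu[\xi(\cdot)\text{ on }S(x)\mid\xi(\cdot)\text{ on }V\setminus T'(x)]=\mu[\xi(\cdot)\text{ on }S(x)\mid\xi(x)]$. A probability measure $\nu$ on $\Xi^{W}$, where $W$ is the vertex set of a tree, is a Markov random field (MRF) if it takes strictly positive values on all finite cylinder sets $\{\xi:\xi(x)=a_x\ \forall x\in\Lambda\}$ ($\Lambda\subset W$ finite, $a\in\Xi^\Lambda$) and, for every $u\in W$, $\nu[\xi(u)\mid\xi(\cdot)\text{ on }W\setminus\{u\}]=\nu[\xi(u)\mid\xi(\cdot)\text{ on the neighbours of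 }u\text{ in }W]$; these conditional probabilities are moreover assumed to be invariant under graph isomorphism. $\mu$ is a Markov chain (MC) over $T$ if it is a probability measure such that for every subtree (connected subgraph) of $T$, with vertex set $V'$, the restriction of $\mu$ to $(\Xi^{V'},\mathcal B_{V'})$ (with $\mathcal B_{V'}$ the cylinder $\sigma$-algebra of $\Xi^{V'}$) is a Markov random field, i.e. $\mu[\xi(x)\mid\xi(\cdot)\text{ on }V'\setminus\{x\}]=\mu[\xi(x)\mid\xi(\cdot)\text{ on }N_x\cap V']$ for all $x\in V'$. *)

(* Defs.v *)
From HB Require Import structures.
From mathcomp Require Import all_boot all_order all_algebra finmap.
From mathcomp Require Import all_classical all_reals all_analysis.
From mathcomp Require Import measurable_realfun.

Set Implicit Arguments.
Unset Strict Implicit.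
Unset Printing Implicit Defensive.

Import Order.TTheory GRing.Theory Num.Theory.

Local Open Scope classical_set_scope.
Local Open Scope ring_scope.

Section graphs.
Context {V : choiceType}.
Implicit Types (e : rel V) (x y o : V).

Definition nbhd e x : set V := [set y | e x y].

Definition gconnected e :=
  forall x y, exists p : seq V, path e x p /\ last x p = y.

(* [x; y] is an [e]-cycle as soon as [x] and [y] are adjacent, so only cycles
   of length at least 3 are cycles of the graph. *)
Definition gacyclic e := forall c : seq V, ucycle e c -> (size c < 3)%N.

Definition is_tree e :=
  [/\ symmetric e, irreflexive e, gconnected e & gacyclic e].

Definition locally_finite e := forall x, finite_set (nbhd e x).

Definition walk_of_length e x y (n : nat) : bool :=
  `[< exists p : seq V, [/\ path e x p, last x p = y & size p = n] >].

(* The value 0 between vertices of different components is junk. *)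
Definition gdist e x y : nat :=
  if pselect (exists n, walk_of_length e x y n) is left h then ex_minn h
  else 0%N.

Definition succs e o x : set V :=
  [set y | e x y /\ (gdist e o x < gdist e o y)%N].

(* The k-th iterate below is S_{k+1}(x). *)
Definition descendants e o x : set V :=
  \bigcup_k iter k (fun A : set V => \bigcup_(y in A) succs e o y)
                 (succs e o x).

End graphs.

Definition induced {V : choiceType} (e : rel V) (V' : set V) : rel V' :=
  fun u v => e (val u) (val v).
Arguments induced {V} e V'.

HB.instance Definition _ (n : nat) := isPointed.Build 'I_n.+1 ord0.

(* The single-site space is 'I_n.+1, i.e. q = n + 1 (q >= 1 is necessary for a
   probability measure to exist). *)
Definition config (V : Type) (n : nat) : Type := V -> 'I_n.+1.

HB.instance Definition _ (V : Type) (n : nat) :=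
  Pointed.copy (config V n) (V -> 'I_n.+1).

Section coordinates.
Context {V : Type} {n : nat}.

Definition coord_sigma (L : set V) : set (set (config V n)) :=
  <<s \bigcup_(u in L)
        preimage_set_system [set: config V n] (fun xi => xi u)
          [set: set 'I_n.+1] >>.

Lemma coord_sigma_algebra L : sigma_algebra setT (coord_sigma L).
Proof. by apply: smallest_sigma_algebra. Qed.

Lemma coord_sigmaS (L L' : set V) : L `<=` L' ->
  coord_sigma L `<=` coord_sigma L'.
Proof.
move=> LL'; apply: sub_smallest2r; first exact: coord_sigma_algebra.
by move=> A [u Lu Au]; exists u => //; exact: LL'.
Qed.

End coordinates.

Definition config_display (V : Type) (n : nat) : measure_display :=
  sigma_display (@coord_sigma V n setT).

HB.instance Definition _ (V : Type) (n : nat) :=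
  @isMeasurable.Build (config_display V n) (config V n)
    (coord_sigma setT) (@sigma_algebra0 _ setT _)
    (@sigma_algebraC (config V n) _) (@sigma_algebra_bigcup _ setT _).

Lemma coord_sigma_measurable {V : Type} {n : nat} (L : set V) :
  @coord_sigma V n L `<=` measurable.
Proof. exact: coord_sigmaS. Qed.

Section restriction.
Context {V : choiceType} {n : nat} {R : realType}.

Definition restrict (V' : set V) (xi : config V n) : config V' n :=
  fun u => xi (val u).

Lemma measurable_restrict (V' : set V) :
  measurable_fun [set: config V n] (@restrict V').
Proof.
apply: measurability; first by reflexivity.
move=> _ [_ [u _ [B _ <-]] <-]; apply: sub_gen_smallest.
by exists (val u) => //; exists B => //; rewrite !setTI.
Qed.

HB.instance Definition _ (V' : set V) :=
  isMeasurableFun.Build _ _ _ _ (@restrict V') (@measurable_restrict V').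

Definition marginal (V' : set V) (mu : probability (config V n) R)
    : probability (config V' n) R :=
  distribution mu (@restrict V').

End restriction.

Section conditional_probability.
Context d {T : measurableType d} {R : realType}.
Implicit Types (P : probability T R) (G : set (set T)) (A : set T).

Definition is_cond_prob P G A (g : T -> R) :=
  [/\ forall Y : set R, measurable Y -> G (g @^-1` Y),
      P.-integrable setT (EFin \o g) &
      forall B, G B -> (\int[P]_(w in B) (g w)%:E = P (A `&` B))%E].

(* A fixed version of P(A | G). When G is a sub-sigma-algebra and A is
   measurable, versions exist (see cond_probP below) and are a.s. unique. *)
Definition cond_prob P G A : T -> R :=
  xget (cst 0) [set g | is_cond_prob P G A g].

Definition cond_independent P G (I : choiceType) (J : set I)
    (H : I -> set (set T)) :=
  forall (K : {fset I}) (A : I -> set T),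
    [set` K] `<=` J -> (forall i, i \in K -> H i (A i)) ->
    {ae P, forall w, cond_prob P G (\bigcap_(i in [set` K]) A i) w =
                     \prod_(i <- K) cond_prob P G (A i) w}.

End conditional_probability.

Section existence.
Context d {T : measurableType d} {R : realType}.
Variables (P : probability T R) (G : set (set T)) (A : set T).
Hypotheses (sG : sigma_algebra setT G) (GT : G `<=` measurable).
Hypothesis mA : measurable A.

Let TG := g_sigma_algebraType G.
Let idG : T -> TG := id.

Let mGE (B : set TG) : measurable B = G B.
Proof. by rewrite -[measurable B]/(<<s G >> B) sigma_algebra_id. Qed.

Let midG : measurable_fun setT idG.
Proof. by move=> _ B; rewrite mGE setTI; exact: GT. Qed.

#[local] HB.instance Definition _ := isMeasurableFun.Build _ _ _ _ idG midG.

Let nu (B : set TG) : \bar R := P (A `&` B).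

Let nuE (B : set TG) : nu B = mrestr P mA B.
Proof. by rewrite /mrestr setIC. Qed.

Let nu0 : nu set0 = 0%E.
Proof. by rewrite nuE measure0. Qed.

Let nu_ge0 B : (0 <= nu B)%E.
Proof. exact: measure_ge0. Qed.

Let nu_sigma_additive : semi_sigma_additive nu.
Proof.
move=> F mF tF mUF; rewrite nuE.
under eq_fun do under eq_bigr do rewrite nuE.
apply: (@measure_semi_sigma_additive _ _ _ (mrestr P mA)) => //.
- by move=> k; apply: GT; rewrite -mGE.
- by apply: GT; rewrite -mGE.
Qed.

#[local] HB.instance Definition _ := isMeasure.Build _ _ _ nu
  nu0 nu_ge0 nu_sigma_additive.

Let nu_fin : fin_num_fun nu.
Proof.
move=> B mB; apply: fin_num_measure.
by apply: measurableI => //; apply: GT; rewrite -mGE.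
Qed.

#[local] HB.instance Definition _ := @Measure_isFinite.Build _ _ _ nu nu_fin.

Lemma cond_probP : is_cond_prob P G A (cond_prob P G A).
Proof.
apply: (@xgetPex _ (cst 0) [set g | is_cond_prob P G A g]).
have nuP : nu `<< distribution P idG.
  apply/null_content_dominatesP => B mB PB; apply/eqP.
  rewrite eq_le measure_ge0 andbT -[leRHS]PB.
  have mB' : d.-measurable B by apply: GT; rewrite -mGE.
  by apply: le_measure; rewrite ?inE//; apply: measurableI.
have [f [f0 ffin fint fE]] := radon_nikodym_sigma_finite nuP.
exists (fine \o f).
have mf := measurable_int _ fint.
have fineK' : EFin \o (fine \o f) = f.
  by apply/funext => w /=; rewrite fineK.
split.
- move=> Y mY; rewrite -mGE -[_ @^-1` _]setTI.
  by apply: (measurableT_comp (fine_measurable measurableT) mf).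
- rewrite fineK'; apply/integrableP; split.
    by apply: (measurableT_comp mf).
  move/integrableP : fint => [_].
  by rewrite ge0_integral_distribution//; apply: measurableT_comp.
- move=> B GB; have mB : measurable (B : set TG) by rewrite mGE.
  rewrite -[RHS]/(nu B) fE// ge0_integral_pushforward//.
    by apply: eq_integral => w _ /=; rewrite fineK.
  exact: (measurable_funTS mf).
Qed.

End existence.

Section markov.
Context {R : realType} {V : choiceType} {n : nat}.
Implicit Types (e : rel V) (mu : probability (config V n) R).

(* mu[xi on A | xi on B] = mu[xi on A | xi on C] *)
Definition eq_cond_law mu (A B C : set V) :=
  forall F, coord_sigma A F ->
    {ae mu, forall xi, cond_prob mu (coord_sigma B) F xi =
                       cond_prob mu (coord_sigma C) F xi}.

Definition block_markov_chain e (o : V) mu :=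
  forall x, eq_cond_law mu (succs e o x) (~` descendants e o x) [set x].

Definition graph_automorphism e (phi : V -> V) :=
  bijective phi /\ {mono phi : u v / e u v}.

(* In [mrf_invariant], xi \o phi is the configuration pulled back along phi:
   the law of the spin at [phi u] given the configuration xi on the
   neighbours of [phi u] is the law of the spin at [u] given xi \o phi on the
   neighbours of [u]. Every cylinder over finitely many sites having positive
   probability, the almost sure identity does not depend on the versions when
   the graph is locally finite. *)
Record markov_random_field e mu : Prop := {
  mrf_positive : forall (L : set V) (a : config V n), finite_set L ->
    (0 < mu [set xi | forall u, L u -> xi u = a u])%E;
  mrf_markov : forall u, eq_cond_law mu [set u] (~` [set u]) (nbhd e u);
  mrf_invariant : forall phi : V -> V, graph_automorphism e phi ->
    forall (u : V) (s : 'I_n.+1),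
    {ae mu, forall xi : config V n,
      cond_prob mu (coord_sigma (nbhd e (phi u)))
                   [set eta | eta (phi u) = s] xi =
      cond_prob mu (coord_sigma (nbhd e u))
                   [set eta | eta u = s] (xi \o phi)} }.

End markov.

(* A connected subgraph of a tree is the subgraph induced on its vertex set. *)
Definition markov_chain {R : realType} {V : choiceType} {n : nat} (e : rel V)
    (mu : probability (config V n) R) :=
  forall V' : set V, V' !=set0 -> gconnected (induced e V') ->
    markov_random_field (induced e V') (marginal V' mu).

(* Main.v *)
Require Import Defs.
From mathcomp Require Import all_boot all_order all_algebra finmap.
From mathcomp Require Import all_classical all_reals all_analysis.
From mathcomp Require Import measurable_realfun.

(** Write [V_0] for the complement of the strict descendants of [x]. For any
    set [s] of successors of [x] and any further successor [y], the graph
    induced on [V_0], [s] and [y] is connected and [y] is a leaf of it, attached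
    to [x]; the Markov property at [y] for the marginal on this subtree gives
    [mu(xi y | V_0, s) = mu(xi y | x)]. Adding the successors one at a time
    yields the product formula. The product only depends on [xi x], so it is
    also the conditional probability given [x]; since [S(x)] is finite, every
    event on [S(x)] is a finite disjoint union of cylinders. *)

Set Implicit Arguments.
Unset Strict Implicit.
Unset Printing Implicit Defensive.

Import Order.TTheory GRing.Theory Num.Theory.

Local Open Scope classical_set_scope.
Local Open Scope ring_scope.

(** * Distances, descendants and connected subgraphs of a rooted tree *)

Section rooted_graph.
Context {V : choiceType} (e : rel V) (o : V).
Hypothesis con : gconnected e.

Lemma gdist_le p : path e o p -> (gdist e o (last o p) <= size p)%N.
Proof.
move=> pp; rewrite /gdist; case: pselect => // h.
by case: ex_minnP => m _; apply; apply/asboolP; exists p.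
Qed.

Lemma gdist_geodesic v :
  exists p, [/\ path e o p, last o p = v & size p = gdist e o v].
Proof.
rewrite /gdist; case: pselect => [h|[]].
  by case: ex_minnP => m /asboolP.
by have [p [pp pl]] := con o v; exists (size p); apply/asboolP; exists p.
Qed.

Lemma gdist_adj u v : e u v -> (gdist e o v <= (gdist e o u).+1)%N.
Proof.
move=> euv; have [p [pp pl <-]] := gdist_geodesic u.
rewrite -(size_rcons p v) -[X in gdist e o X](last_rcons o p v).
by apply: gdist_le; rewrite rcons_path pp pl.
Qed.

Lemma gdist_parent v : v != o ->
  exists2 u, e u v & (gdist e o u < gdist e o v)%N.
Proof.
have [p [pp pl <-]] := gdist_geodesic v.
case/lastP: p pp pl => [_ /= -> /eqP//|p w].
rewrite rcons_path last_rcons size_rcons => /andP[pp epw] <- _.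
by exists (last o p); rewrite ?ltnS ?gdist_le.
Qed.

Lemma succs_gdist x y : succs e o x y -> gdist e o y = (gdist e o x).+1.
Proof.
by move=> [exy xy]; apply/eqP; rewrite eqn_leq xy (gdist_adj exy).
Qed.

Lemma succs_descendants x : succs e o x `<=` descendants e o x.
Proof. by move=> y xy; exists 0%N. Qed.

Lemma descendants_succs x u v :
  descendants e o x u -> succs e o u v -> descendants e o x v.
Proof. by move=> [k _ ku] uv; exists k.+1 => //; exists u. Qed.

Lemma descendants_gdist x v :
  descendants e o x v -> (gdist e o x < gdist e o v)%N.
Proof.
move=> [k _]; elim: k v => [v [_]//|k IH v [u /IH xu [_]]].
exact: ltn_trans.
Qed.

Lemma not_descendants_self x : ~ descendants e o x x.
Proof. by move=> /descendants_gdist; rewrite ltnn. Qed.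

Hypotheses (esym : symmetric e) (eirr : irreflexive e).

(** Strong induction on the distance to [o], moving to a parent each time. The strict bound keeps
    the path away from vertices at least as far from [o] as [v]. *)
Lemma descending_path v :
  exists p, [/\ path e v p, last v p = o &
    forall w, w \in p -> (gdist e o w < gdist e o v)%N].
Proof.
have [m] := ubnP (gdist e o v); elim: m v => // m IH v; rewrite ltnS => vm.
have [->|vo] := eqVneq v o; first by exists [::].
have [u euv uv] := gdist_parent vo.
have [p [pp pl pm]] := IH u (leq_trans uv vm).
exists (u :: p); split => //=; first by rewrite esym euv.
by move=> w; rewrite inE => /predU1P[-> //|/pm /ltn_trans]; apply.
Qed.

(** Iterating parents inside [W] leads every vertex of [W] to the root; one such descent followed by
    another reversed joins any two vertices. *)
Lemma gconnected_induced (W : set V) :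
  (forall v, W v -> v != o ->
     exists u, [/\ W u, e u v & (gdist e o u < gdist e o v)%N]) ->
  gconnected (Defs.induced e W).
Proof.
move=> Wparent.
have to_root (v : W) :
    exists p, path (Defs.induced e W) v p /\ val (last v p) = o.
  have [m] := ubnP (gdist e o (val v)); elim: m v => // m IH v.
  rewrite ltnS => vm.
  have [vo|vo] := eqVneq (val v) o; first by exists [::].
  have [u [Wu euv uv]] := Wparent _ (set_valP v) vo.
  have [p [pp pl]] := IH (SigSub (mem_set Wu)) (leq_trans uv vm).
  exists (SigSub (mem_set Wu) :: p); split => //=.
  by rewrite pp andbT /Defs.induced /= esym.
move=> v w; have [p [pp pl]] := to_root v; have [q [qp ql]] := to_root w.
(* [belast] drops the root, already reached at the end of [p]; the reversal then ends at [w]. *)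
exists (p ++ rev (belast w q)); rewrite cat_path last_cat pp /=.
have -> : last v p = last w q by apply: val_inj; rewrite pl ql.
split; last by case: q {qp ql} => //= a q; rewrite rev_cons last_rcons.
rewrite rev_path; apply: sub_path qp => a b; by rewrite /Defs.induced /= esym.
Qed.

Hypothesis acy : gacyclic e.

(* Geodesics from [x] and [z] to the root avoid [y], so [x != z] would close a
   cycle through [y]. *)
Lemma parent_uniq x y z : succs e o x y -> e y z ->
  (gdist e o z <= gdist e o y)%N -> z = x.
Proof.
move=> xy eyz zy; apply/eqP/negPn/negP => zx.
have [p [pp pl pm]] := descending_path x.
have [q [qp ql qm]] := descending_path z.
pose r := p ++ rev (belast z q).
have rp : path e x r.
  rewrite cat_path pp pl -ql rev_path /=.
  by apply: sub_path qp => a b; rewrite esym.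
have rl : last x r = z.
  rewrite last_cat pl; case: (q) ql => [//= -> //|a q' _].
  by rewrite /= rev_cons last_rcons.
have xy_lt : (gdist e o x < gdist e o y)%N by case: xy.
have yr : y \notin x :: r.
  rewrite inE negb_or; apply/andP; split.
    by apply/eqP => yx; rewrite yx ltnn in xy_lt.
  rewrite mem_cat mem_rev negb_or; apply/andP; split.
    by apply/negP => /pm /(ltn_trans xy_lt); rewrite ltnn.
  apply/negP => /mem_belast; rewrite inE => /predU1P[yz|/qm].
    by rewrite yz eirr in eyz.
  by move=> /leq_trans /(_ zy); rewrite ltnn.
(* A simple path from [x] to [z] avoiding [y] closes up through [y]; acyclicity leaves only the
   empty path, that is [z = x]. *)
case/shortenP: rp rl yr => r' r'p r'u r'r r'l yr.
have exy : e x y by case: xy.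
have := acy (c := y :: x :: r'); rewrite /ucycle.
have -> : cycle e (y :: x :: r').
  by rewrite /= rcons_path r'l (esym y x) exy r'p (esym z y) eyz.
have -> : uniq (y :: x :: r').
  rewrite cons_uniq r'u andbT; apply: contra yr.
  by rewrite !inE => /orP[->//|/r'r ->]; rewrite orbT.
move=> /(_ isT); case: r' r'l {r'p r'u r'r} => [/= xz|//].
by rewrite xz eqxx in zx.
Qed.

Variable x : V.
Let outer : set V := ~` descendants e o x.

(** A parent of a non-descendant of [x] is again a non-descendant, and the vertices of [s] hang from
    [x], which is not its own descendant. *)
Lemma outer_succs_gconnected (s : set V) : s `<=` succs e o x ->
  gconnected (Defs.induced e (outer `|` s)).
Proof.
move=> sx; apply: gconnected_induced => v [xv|sv] vo.
  have [u euv uv] := gdist_parent vo; exists u; split => //; left => xu.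
  by apply: xv; apply: descendants_succs xu _.
by have [exv xv] := sx _ sv; exists x; split => //; left;
  exact: not_descendants_self.
Qed.

(** By [parent_uniq], a neighbour of [y] other than [x] is a successor of [y]: it descends from [x],
    and it is one level too deep to be in [s]. *)
Lemma outer_succs_leaf (s : set V) y : s `<=` succs e o x -> succs e o x y ->
  (outer `|` s) `&` nbhd e y = [set x].
Proof.
move=> sx xy; apply/seteqP; split=> [z [Wz eyz]|_ ->].
  apply: (parent_uniq xy) => //; rewrite leqNgt; apply/negP => yz.
  case: Wz => [|/sx xz]; last first.
    by rewrite (succs_gdist xz) (succs_gdist xy) ltnn in yz.
  by apply; apply: (descendants_succs (succs_descendants xy)).
split; first by left; exact: not_descendants_self.
by rewrite /nbhd /= esym; case: xy.
Qed.

End rooted_graph.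

(** * Almost sure uniqueness of conditional probabilities *)

Section cond_prob_uniq.
Context d {T : measurableType d} {R : realType}.
Variables (P : probability T R) (G : set (set T)) (A : set T).
Hypotheses (sG : sigma_algebra setT G) (GT : G `<=` measurable).
Hypothesis mA : measurable A.

(** The event [B] where [g] exceeds [g'] belongs to [G], so both functions have integral [P (A]&[B)]
    over it; a positive function with zero integral forces [B] to be null. *)
Lemma is_cond_prob_le g g' : is_cond_prob P G A g -> is_cond_prob P G A g' ->
  {ae P, forall w, g w <= g' w}.
Proof.
move=> [mg ig Eg] [mg' ig' Eg'].
have mG (h : T -> R) : (forall Y, measurable Y -> G (h @^-1` Y)) ->
    measurable_fun [set: g_sigma_algebraType G] h.
  by move=> mh _ Y mY; rewrite setTI; apply: sub_gen_smallest; exact: mh.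
pose B := (g \- g') @^-1` `]0, +oo[%classic.
have GB : G B.
  have := measurable_funB (mG _ mg) (mG _ mg') measurableT
    (measurable_itv `]0, +oo[).
  by rewrite setTI -[measurable _]/(<<s G >> _) sigma_algebra_id.
have mB := GT GB.
have iB (h : T -> \bar R) : P.-integrable setT h -> P.-integrable B h.
  exact: integrableS.
have /iB/measurable_int mh := integrableB measurableT ig ig'.
have IB : (\int[P]_(w in B) ((g w)%:E - (g' w)%:E) = 0)%E.
  rewrite integralB//; try exact: iB.
  by rewrite Eg// Eg'// subee// fin_num_measure//; exact: measurableI.
have /ae_eq_integral_abs : (\int[P]_(w in B) `|(g w)%:E - (g' w)%:E| = 0)%E.
  rewrite -[RHS]IB; apply: eq_integral => w; rewrite inE /B /= => Bw.
  by rewrite in_itv /= andbT in Bw; rewrite ger0_norm// ltW.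
move=> /(_ mB mh); apply: filterS => w /= Bw.
rewrite leNgt; apply/negP => g'g.
have /Bw[] : B w by rewrite /B /= in_itv /= andbT subr_gt0.
by move=> /eqP; rewrite subr_eq0 gt_eqF.
Qed.

Lemma is_cond_prob_ae_eq g : is_cond_prob P G A g ->
  {ae P, forall w, cond_prob P G A w = g w}.
Proof.
move=> Pg; have Pc := cond_probP P sG GT mA.
have := is_cond_prob_le Pg Pc; apply: filterS2 (is_cond_prob_le Pc Pg).
by move=> w gc cg; apply/eqP; rewrite eq_le gc.
Qed.

End cond_prob_uniq.

(** Used twice: for the spin at [x], and for the trace of a configuration on finitely many sites. *)
Lemma measure_fibers d (T : measurableType d) (R : realType)
    (mu : {measure set T -> \bar R}) (I : finType) (f : T -> I) (D : set T) :
  measurable D -> (forall i, measurable (f @^-1` [set i])) ->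
  mu D = (\sum_i mu (D `&` f @^-1` [set i]))%E.
Proof.
move=> mD mf; rewrite (@fsbig_seq _ _ _ _ (index_enum I)) ?index_enum_uniq//.
rewrite -measure_fin_bigcup.
- rewrite -setI_bigcupr; congr (mu _); apply/esym/setIidPl => w _.
  by exists (f w) => //=; rewrite mem_index_enum.
- exact: finite_seq.
- by move=> i j _ _ [w [[_ <-] [_ <-]]].
- by move=> i _; exact: measurableI.
Qed.

(** * Events depending on given coordinates *)

Section coordinate_events.
Context {V : choiceType} {n : nat}.
Implicit Types (L : set V) (x : V) (s : 'I_n.+1).

Local Notation spin x s := [set xi : config V n | xi x = s].

Lemma coord_sigma_fun L x (Y : set 'I_n.+1) : L x ->
  coord_sigma L [set xi : config V n | Y (xi x)].
Proof.
move=> Lx; apply: sub_gen_smallest; exists x => //.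
by exists Y => //; rewrite setTI.
Qed.

Lemma coord_sigma_spin L x s : L x -> coord_sigma L (spin x s).
Proof. by move=> Lx; exact: (@coord_sigma_fun _ _ [set s]). Qed.

Lemma measurable_spin x s : measurable (spin x s).
Proof. exact: (@coord_sigma_spin setT). Qed.

Lemma coord_sigmaI L (A B : set (config V n)) :
  coord_sigma L A -> coord_sigma L B -> coord_sigma L (A `&` B).
Proof.
by move=> LA LB;
  exact: (@measurableI _ (g_sigma_algebraType
    (\bigcup_(u in L) preimage_set_system [set: config V n] (fun xi => xi u)
       [set: set 'I_n.+1]))).
Qed.

Lemma coord_sigmaT L : coord_sigma L [set: config V n].
Proof.
exact: (@measurableT _ (g_sigma_algebraType
    (\bigcup_(u in L) preimage_set_system [set: config V n] (fun xi => xi u)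
       [set: set 'I_n.+1]))).
Qed.

Definition cylinder (r : seq V) (a : config V n) : set (config V n) :=
  [set xi | forall y, y \in r -> xi y = a y].

Lemma cylinder_nil a : cylinder [::] a = setT.
Proof. by apply/seteqP. Qed.

Lemma cylinder_cons y r a :
  cylinder (y :: r) a = spin y (a y) `&` cylinder r a.
Proof.
apply/seteqP; split=> [xi h|xi [xiy h] z].
  split; first by apply: h; rewrite mem_head.
  by move=> z zr; apply: h; rewrite inE zr orbT.
by rewrite inE => /predU1P[->//|/h].
Qed.

Lemma coord_sigma_cylinder L r a : [set` r] `<=` L ->
  coord_sigma L (cylinder r a).
Proof.
elim: r => [|y r IH] rL; first by rewrite cylinder_nil; exact: coord_sigmaT.
rewrite cylinder_cons; apply: coord_sigmaI.
  by apply: coord_sigma_spin; apply: rL; rewrite /= mem_head.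
by apply: IH => z zr; apply: rL => /=; rewrite inE; apply/orP; right.
Qed.

(** The events that do not separate [xi] from [eta] form a sigma-algebra containing the
    generators. *)
Lemma coord_sigma_dep L (F : set (config V n)) xi eta : coord_sigma L F ->
  (forall u, L u -> xi u = eta u) -> F xi <-> F eta.
Proof.
move=> LF xiL; move: F LF.
apply: (@smallest_sub _ _ _ [set F : set (config V n) | F xi <-> F eta]).
- split => //=.
  + by move=> F FE; rewrite /setD /= FE.
  + by move=> F FE; split=> -[k _ Fk]; exists k => //; apply/FE.
- by move=> _ [u Lu [Y _ <-]]; rewrite setTI /= xiL.
Qed.

End coordinate_events.

(** Preimages under the restriction form a sigma-algebra containing the generators. This carries
    events on [L] over to the space on which the marginal lives. *)
Lemma coord_sigma_restrict (V : choiceType) (n : nat) (W L : set V)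
    (B : set (config V n)) :
  L `<=` W -> coord_sigma L B ->
  exists2 B', coord_sigma [set u : W | L (val u)] B' &
    B = @Defs.restrict V n W @^-1` B'.
Proof.
move=> LW LB.
have [B' LB' <-] : preimage_set_system setT (@Defs.restrict V n W)
    (coord_sigma [set u : W | L (val u)]) B.
  move: B LB; apply: smallest_sub.
    by apply: sigma_algebra_preimage; exact: coord_sigma_algebra.
  move=> _ [u Lu [Y _ <-]].
  pose v : W := SigSub (mem_set (LW _ Lu)).
  exists [set xi : config W n | Y (xi v)]; last by rewrite !setTI.
  exact: coord_sigma_fun.
by exists B' => //; rewrite setTI.
Qed.

(** * Conditional probabilities that depend only on the spin at one site *)

Section site_kernel.
Context {V : choiceType} {n : nat} {R : realType}.
Variables (P : probability (config V n) R) (x : V).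
Implicit Types (L : set V) (F B : set (config V n)) (c : 'I_n.+1 -> R).

Local Notation spin x s := [set xi : config V n | xi x = s].

(* For [x] in [L], this says that [c (xi x)] is a version of [P(F | F_L)]. *)
Definition site_kernel L F c := forall B, coord_sigma L B -> forall s,
  P (F `&` (B `&` spin x s)) = ((c s)%:E * P (B `&` spin x s))%E.

(* If [xi x = s] is a null event, this is [0 / 0 = 0]; any value would do. *)
Definition transition F s : R := fine (P (F `&` spin x s)) / fine (P (spin x s)).

Lemma site_kernelS L L' F c : L' `<=` L ->
  site_kernel L F c -> site_kernel L' F c.
Proof. by move=> L'L LF B /(coord_sigmaS L'L); exact: LF. Qed.

(** Taking [B] to be the whole space determines [c s] unless [xi x = s] is null, and then both sides
    vanish. Every kernel can thus be replaced by one formula free of [L]. *)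
Lemma site_kernel_transition L F c : measurable F ->
  site_kernel L F c -> site_kernel L F (transition F).
Proof.
move=> mF LF B LB s; have mx := @measurable_spin V n x s.
have [x0|x0] := eqVneq (P (spin x s)) 0%E.
  have null D : measurable D -> P (D `&` spin x s) = 0%E.
    move=> mD; apply: (subset_measure0 _ _ _ x0) => //.
    exact: measurableI.
  have mB := coord_sigma_measurable LB.
  by rewrite setIA !null ?mule0//; exact: measurableI.
rewrite LF//; congr (_%:E * _)%E.
have := LF _ (@coord_sigmaT V n L) s; rewrite setTI /transition => ->.
rewrite fineM ?fin_num_measure//= mulfK//.
by rewrite fine_eq0 ?fin_num_measure.
Qed.

(** Splitting [B] by the value of [xi x] makes the integrand constant on each piece. *)
Lemma is_cond_prob_site L F c : L x -> measurable F -> site_kernel L F c ->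
  is_cond_prob P (coord_sigma L) F (fun xi => c (xi x)).
Proof.
move=> Lx mF LF.
have mc : measurable_fun setT (fun xi : config V n => c (xi x)).
  move=> _ Y _; rewrite setTI.
  by apply: coord_sigma_measurable; exact: (@coord_sigma_fun _ _ _ _ (c @^-1` Y)).
have mspin (s : 'I_n.+1) : measurable ((fun xi : config V n => xi x) @^-1` [set s]).
  exact: measurable_spin.
split.
- by move=> Y _; exact: (@coord_sigma_fun _ _ _ _ (c @^-1` Y)).
- apply: measurable_bounded_integrable => //.
    by rewrite ltey_eq fin_num_measure.
  exists (\sum_s `|c s|); split => [|M cM xi _ /=]; first exact: num_real.
  apply: le_trans (ltW cM).
  by rewrite (bigD1 (xi x))//= lerDl sumr_ge0.
- move=> B LB; have mB := coord_sigma_measurable LB.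
  have mBs s : measurable (B `&` spin x s) by exact: measurableI (mspin s).
  have BE : B = \big[setU/set0]_(s <- index_enum 'I_n.+1) (B `&` spin x s).
    rewrite -bigcup_seq -setI_bigcupr; apply/esym/setIidPl => xi _.
    by exists (xi x) => //=; rewrite mem_index_enum.
  rewrite (measure_fibers _ (measurableI _ _ mF mB) mspin) [in LHS]BE.
  rewrite integral_bigsetU_EFin//= ?index_enum_uniq//; last 2 first.
  + by move=> s t _ _ [xi [[_ <-] [_ <-]]].
  + by apply/measurable_EFinP; apply: measurable_funTS.
  apply: eq_bigr => s _; rewrite -setIA LF// -integral_cst//.
  by apply: eq_integral => xi /[1!inE] -[_ /= ->].
Qed.

Lemma cond_prob_site L F c : L x -> measurable F -> site_kernel L F c ->
  {ae P, forall xi, cond_prob P (coord_sigma L) F xi = c (xi x)}.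
Proof.
move=> Lx mF LF; apply: is_cond_prob_ae_eq => //.
- exact: coord_sigma_algebra.
- exact: coord_sigma_measurable.
- exact: is_cond_prob_site.
Qed.

(** A version given the spin at [x] is a function of that spin; by assumption it is also a version
    given [L], and integrating it over [B]&[spin x s] gives the kernel identity. *)
Lemma eq_cond_law_site A L F : L x -> coord_sigma A F ->
  eq_cond_law P A L [set x] -> exists c, site_kernel L F c.
Proof.
move=> Lx AF /(_ F AF) LF; have mF := coord_sigma_measurable AF.
pose g := cond_prob P (coord_sigma [set x]) F.
have [mg ig _] : is_cond_prob P (coord_sigma [set x]) F g.
  apply: cond_probP => //; first exact: coord_sigma_algebra.
  exact: coord_sigma_measurable.
have [_ ih Eh] := cond_probP P (coord_sigma_algebra L)
  (@coord_sigma_measurable _ _ L) mF.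
(* The level set of [g] through [xi] is an event at [x], so it contains the constant configuration
   with value [xi x]. *)
have gE xi : g xi = g (cst (xi x)).
  have [|+ _] := @coord_sigma_dep _ _ _ _ xi (cst (xi x))
    (mg _ (measurable_set1 (g xi))); first by move=> u ->.
  by move=> ->.
exists (fun s => g (cst s)) => B LB s.
have LBs : coord_sigma L (B `&` spin x s).
  by apply: coord_sigmaI => //; exact: coord_sigma_spin.
have mBs := coord_sigma_measurable LBs.
rewrite -Eh// -integral_cst//.
transitivity (\int[P]_(xi in B `&` spin x s) (g xi)%:E)%E.
  apply: ae_eq_integral => //.
  - by apply: measurable_funTS; exact: measurable_int ih.
  - by apply: measurable_funTS; exact: measurable_int ig.
  - by apply: filterS LF => xi /= ->.
by apply: eq_integral => xi /[1!inE] -[_ /= <-]; rewrite gE.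
Qed.

(** Chain rule: the tail is conditioned on [B], the head on [B] and the tail cylinder together.
    Quantifying over all [t] inside [r] lets the hypothesis pass to the tail. *)
Lemma site_kernel_chain L r (a : config V n) (g : V -> 'I_n.+1 -> R) :
  uniq r -> (forall y (t : seq V), y \in r -> [set` t] `<=` [set` r] -> y \notin t ->
    site_kernel (L `|` [set` t]) (spin y (a y)) (g y)) ->
  site_kernel L (cylinder r a) (fun s => \prod_(y <- r) g y s).
Proof.
elim: r => [_ _ B _ s|y r IH /= /andP[yr ur] rc B LB s].
  by rewrite cylinder_nil setTI big_nil mul1e.
have rsub : [set` r] `<=` [set` y :: r].
  by move=> z zr /=; rewrite inE; apply/orP; right.
rewrite cylinder_cons big_cons EFinM -muleA -IH//; last first.
  move=> z t zr tr; apply: rc; first by rewrite inE zr orbT.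
  exact: subset_trans tr rsub.
rewrite -setIA [in RHS]setIA (setIA _ B) (rc y r)//; first by rewrite mem_head.
apply: coord_sigmaI; last exact: coord_sigmaS LB.
by apply: coord_sigma_cylinder.
Qed.

Lemma site_kernel_finite L S F : finite_set S -> coord_sigma S F ->
  (forall a, exists c, site_kernel L (cylinder (fset_set S) a) c) ->
  exists c, site_kernel L F c.
Proof.
move=> finS SF /choice[c cP]; set E := fset_set S.
have mF := coord_sigma_measurable SF.
pose trace (xi : config V n) : {ffun E -> 'I_n.+1} := [ffun u => xi (val u)].
(* The default [ord0] off [E] is harmless: membership in [F] depends only on the sites of [S]. *)
pose ext (f : {ffun E -> 'I_n.+1}) : config V n :=
  fun v => oapp f ord0 (insub v).
have extE f (u : E) : ext f (val u) = f u by rewrite /ext valK.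
have traceE f : trace @^-1` [set f] = cylinder E (ext f).
  apply/seteqP; split=> [xi /= <- y yE|xi h].
    by rewrite -[y]/(val [` yE]%fset) extE ffunE.
  by apply/ffunP => u; rewrite ffunE h ?extE//; exact: valP.
have mcyl r a : measurable (@cylinder V n r a).
  by apply: (@coord_sigma_cylinder _ _ setT).
(* The kernels of the cylinders that make up [F] are added. *)
exists (fun s => \sum_f (if ext f \in F then c (ext f) s else 0)) => B LB s.
have mBs : measurable (B `&` spin x s).
  by apply: measurableI (@measurable_spin _ _ _ _); exact: coord_sigma_measurable LB.
rewrite (@measure_fibers _ _ _ _ _ trace)//; first last.
- by move=> f; rewrite traceE.
- exact: measurableI.
rewrite -[X in (_ * X)%E]fineK ?fin_num_measure// -EFinM mulr_suml -sumEFin.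
apply: eq_bigr => f _; rewrite EFinM fineK ?fin_num_measure// traceE.
have FE xi : cylinder E (ext f) xi -> F xi <-> F (ext f).
  by move=> xif; apply: (coord_sigma_dep SF) => u Su; apply: xif;
    rewrite in_fset_set// inE.
case: ifPn => [/set_mem Ff|/negP Ff].
  rewrite -cP//; congr (P _); apply/seteqP; split=> [xi [[_ ?] ?]//|xi [xif ?]].
  by split=> //; split=> //; apply/FE.
rewrite mul0e -(measure0 P); congr (P _); apply/seteqP; split=> // xi [[Fxi _] xif].
by apply: Ff; apply/mem_set/(FE _ xif).
Qed.

End site_kernel.

(** * Conditional laws of the successors under a Markov chain *)

Section markov_chain_tree.
Context {R : realType} {V : choiceType} {n : nat} (e : rel V) (o : V).
Variable mu : probability (config V n) R.
Hypotheses (tree_e : is_tree e) (lf : locally_finite e).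
Hypothesis MC : markov_chain e mu.
Variable x : V.

Local Notation spin y t := [set xi : config V n | xi y = t].
Let outer : set V := ~` descendants e o x.

Let outer_x : outer x.
Proof. by case: tree_e => _ _ con _; exact: not_descendants_self. Qed.

Lemma finite_succs : finite_set (succs e o x).
Proof. by apply: sub_finite_set (lf x) => y []. Qed.

(** The kernel is the same for every [s]: the chain rule can use it at each stage, and the case of
    empty [s] identifies it with conditioning on [x] alone. *)
Lemma site_kernel_succ (s : seq V) y t :
  [set` s] `<=` succs e o x -> succs e o x y -> y \notin s ->
  site_kernel mu x (outer `|` [set` s]) (spin y t)
    (transition mu x (spin y t)).
Proof.
move=> sx xy ys; have [esym eirr con acy] := tree_e.
have ysx : [set` y :: s] `<=` succs e o x.
  by move=> z /=; rewrite inE => /predU1P[->//|/sx].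
pose W := outer `|` [set` y :: s].
have Wy : W y by right; rewrite /= mem_head.
have Wx : W x by left.
have yx : y != x.
  by apply: contraPneq xy => -> []; rewrite eirr.
have [_ mrf _] := MC (ex_intro _ x Wx) (outer_succs_gconnected con esym ysx).
pose y' : W := SigSub (mem_set Wy); pose x' : W := SigSub (mem_set Wx).
have nbhd_y : nbhd (Defs.induced e W) y' = [set x'].
  have leaf := outer_succs_leaf con esym eirr acy ysx xy.
  apply/seteqP; split=> [u yu|_ ->].
    apply/val_inj; suff : [set x] (val u) by [].
    by rewrite -leaf; split => //; exact: set_valP.
  suff : (W `&` nbhd e y) x by case.
  by rewrite leaf.
have := mrf y'; rewrite nbhd_y => law.
(* The side condition is that [x'] lies in the conditioning set, the complement of [y']. *)
have [|c cP] := eq_cond_law_site _ (coord_sigma_spin t (erefl : [set y'] y')) law.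
  by move=> /= xy'; move: yx; rewrite -[y]/(val y') -xy' eqxx.
apply: (@site_kernel_transition _ _ _ _ _ _ _ c); first exact: measurable_spin.
have LW : outer `|` [set` s] `<=` W.
  by move=> z [|zs]; [left|right; rewrite /= inE zs orbT].
(* [B] comes from an event on [W] whose coordinates avoid [y], and the marginal of that event is by
   definition [mu] of its preimage. *)
move=> B LB r; have [B' LB' ->] := coord_sigma_restrict LW LB.
apply: cP; apply: coord_sigmaS LB' => u /= Lu uy.
case: Lu; rewrite uy /=; last by apply/negP.
by apply; exact: succs_descendants.
Qed.

Lemma site_kernel_succs (a : config V n) :
  site_kernel mu x outer (cylinder (fset_set (succs e o x)) a)
    (fun s => \prod_(y <- fset_set (succs e o x))
                transition mu x (spin y (a y)) s).
Proof.
have inS y : y \in fset_set (succs e o x) -> succs e o x y.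
  by rewrite in_fset_set ?inE//; exact: finite_succs.
apply: site_kernel_chain => [|y s yS sS ys]; first exact: fset_uniq.
by apply: site_kernel_succ => // [z /sS/inS//|]; exact: inS.
Qed.

Lemma cond_prob_succ y t : succs e o x y ->
  {ae mu, forall xi, cond_prob mu (coord_sigma [set x]) (spin y t) xi =
                     transition mu x (spin y t) (xi x)}.
Proof.
move=> xy; apply: cond_prob_site => //; first exact: measurable_spin.
apply: site_kernelS (@site_kernel_succ [::] y t _ xy _) => //.
by move=> _ ->; left.
Qed.

Lemma cylinder_succs (a : config V n) :
  cylinder (fset_set (succs e o x)) a =
  [set eta | forall y, succs e o x y -> eta y = a y].
Proof.
have inS y : y \in fset_set (succs e o x) <-> succs e o x y.
  by rewrite in_fset_set ?inE//; exact: finite_succs.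
by apply/seteqP; split=> xi h y /inS; exact: h.
Qed.

Lemma cond_prob_succs (a : config V n) :
  {ae mu, forall xi,
    cond_prob mu (coord_sigma outer)
      [set eta | forall y, succs e o x y -> eta y = a y] xi =
    \prod_(y <- fset_set (succs e o x))
      cond_prob mu (coord_sigma [set x]) (spin y (a y)) xi}.
Proof.
rewrite -cylinder_succs.
have mC : measurable (cylinder (fset_set (succs e o x)) a).
  by apply: (@coord_sigma_cylinder _ _ setT).
have := cond_prob_site outer_x mC (site_kernel_succs a).
set S := fset_set _.
(* Only finitely many successors occur, so their exceptional null sets can be discarded together. *)
have : {ae mu, forall xi, (\bigcap_(y in [set` S]) [set eta |
    cond_prob mu (coord_sigma [set x]) (spin y (a y)) eta =
    transition mu x (spin y (a y)) (eta x)]) xi}.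
  apply: filter_bigI => y; rewrite in_fset_set; last exact: finite_succs.
  by rewrite inE => xy; exact: cond_prob_succ.
apply: filterS2 => xi xiS ->; rewrite big_seq [RHS]big_seq.
by apply: eq_bigr => y /xiS /= ->.
Qed.

(** A single kernel [c] serves both sides: valid for [outer], it stays valid for the smaller set
    containing only [x], so both conditional probabilities equal [c (xi x)]. *)
Lemma eq_cond_law_succs : eq_cond_law mu (succs e o x) outer [set x].
Proof.
move=> F SF; have mF := coord_sigma_measurable SF.
have [|c cP] := site_kernel_finite finite_succs SF (P := mu) (x := x) (L := outer).
  by move=> a; eexists; exact: site_kernel_succs.
have xouter : [set x] `<=` outer by move=> _ ->.
have := cond_prob_site (erefl : [set x] x) mF (site_kernelS xouter cP).
by apply: filterS2 (cond_prob_site outer_x mF cP) => xi -> ->.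
Qed.

End markov_chain_tree.

Theorem theorem3 (R : realType) (V : choiceType) (e : rel V) (o : V) (n : nat)
    (mu : probability (config V n) R) :
  infinite_set [set: V] -> is_tree e -> locally_finite e ->
  markov_chain e mu ->
  (forall (x : V) (a : config V n),
     {ae mu, forall xi,
       cond_prob mu (coord_sigma (~` descendants e o x))
         [set eta | forall y, succs e o x y -> eta y = a y] xi =
       \prod_(y <- fset_set (succs e o x))
         cond_prob mu (coord_sigma [set x]) [set eta | eta y = a y] xi}) /\
  ((forall x : V, cond_independent mu (coord_sigma [set x]) (succs e o x)
                    (fun y => coord_sigma [set y])) ->
   block_markov_chain e o mu).
Proof.
move=> _ tree_e lf MC; split=> [x a|_ x]; first exact: cond_prob_succs.
exact: eq_cond_law_succs.
Qed.
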